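(* Suppose that $-1\le\beta<\alpha<1$ and $\beta<0$, and put $\mu=\frac{1-\beta}{\alpha-\beta}$. If $S$ is a spherical $\{\alpha,\beta\}$-code of size $n$ and rank $r$, and $A$ denotes the adjacency matrix of the graph $G=\Gamma_\alpha(S)$, then the following hold: (1) The smallest eigenvalue satisfies $\lambda_n(G)\ge-\mu$. (2) ${\rm j}\in R(A+\mu I)$, ${\rm j}^\top(A+\mu I)^\#{\rm j}\le\frac{\alpha-\beta}{-\beta}$, and $$\mathrm{rank}(A+\mu I)=\begin{cases} r+1 & \text{if } {\rm j}^\top(A+\mu I)^\#{\rm j}=\frac{\alpha-\beta}{-\beta},\\ r & \text{otherwise.}\end{cases}$$ Conversely, if an $n$-vertex graph $G$ with adjacency matrix $A$ satisfies (1) and (2) (for an integer $r$), then there exists a spherical $\{\alpha,\beta\}$-code $S$ of rank $r$ such that $\Gamma_\alpha(S)=G$.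
   Context: For $\beta<\alpha<1$, a spherical $\{\alpha,\beta\}$-code is a finite nonempty set $S$ of unit vectors in some $\mathbb{R}^m$ such that $x^\top y\in\{\alpha,\beta\}$ for any two distinct $x,y\in S$ (it is allowed that only one of the values occurs). The rank of $S$ is the dimension of the linear span of $S$, equivalently the rank of the Gram matrix of $S$. For $S=\{u_1,\dots,u_n\}$, the associated $\alpha$-graph $\Gamma_\alpha(S)$ is the simple graph with vertex set $S$ in which distinct $u_i,u_j$ are adjacent iff $u_i^\top u_j=\alpha$. Equality $\Gamma_\alpha(S)=G$ is understood up to graph isomorphism. Graphs are finite and simple; $\lambda_1(G)\ge\cdots\ge\lambda_n(G)$ are the eigenvalues of the adjacency matrix of an $n$-vertex graph $G$. ${\rm j}$ is the all-ones column vector, $I$ the identity matrix, and $R(M)$ the column space of a matrix $M$. The group inverse $M^\#$ of a square matrix $M$ is the (unique, if it exists) matrix $X$ with $MXM=M$, $XMX=X$, $MX=XM$; it exists for every real symmetric matrix. *)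

(* Defs.v *)
From mathcomp Require Import all_boot all_order all_algebra.
From mathcomp Require Import finmap.
From mathcomp Require Import boolp classical_sets reals.

Set Implicit Arguments.
Unset Strict Implicit.
Unset Printing Implicit Defensive.

Import Order.TTheory GRing.Theory Num.Theory.
Local Open Scope ring_scope.

Record sgraph := SGraph {
  svertex :> finType;
  sedge : rel svertex;
  sedge_sym : symmetric sedge;
  sedge_irr : irreflexive sedge }.

Definition sgraph_iso (G H : sgraph) : Prop :=
  exists2 f : G -> H, bijective f & {mono f : x y / sedge x y}.

(* Rows and columns follow the canonical enumeration of the vertices; another
   ordering conjugates the matrix by a permutation matrix. *)
Definition adjmx (R : realType) (G : sgraph) : 'M[R]_#|G| :=
  \matrix_(i, j) (sedge (enum_val i) (enum_val j))%:R.

(* The nonincreasing list of the eigenvalues of A, repeated according to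
   multiplicity; the default [::] is only taken when char_poly A does not split
   over R, so never for a symmetric A. *)
Definition eigvals (R : realType) (n : nat) (A : 'M[R]_n) : seq R :=
  xget [::] [set s : seq R | sorted >=%R s /\
                             char_poly A = \prod_(x <- s) ('X - x%:P)].

(* Numbered from 1: lambda A 1 is the largest eigenvalue and lambda A n the
   smallest one. *)
Definition lambda (R : realType) (n : nat) (A : 'M[R]_n) (k : nat) : R :=
  nth 0 (eigvals A) k.-1.

Definition is_group_inverse (R : realType) (n : nat) (M X : 'M[R]_n) : Prop :=
  [/\ M *m X *m M = M, X *m M *m X = X & M *m X = X *m M].

(* The default 0 is only taken when no group inverse exists, so never for a
   symmetric M. *)
Definition group_inverse (R : realType) (n : nat) (M : 'M[R]_n) : 'M[R]_n :=
  xget 0 [set X | is_group_inverse M X].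

Definition colspace (R : realType) (m n : nat) (M : 'M[R]_(m, n)) :
    set 'cV[R]_m :=
  range (fun x : 'cV[R]_n => M *m x).

Definition dotv (R : realType) (m : nat) (x y : 'cV[R]_m) : R :=
  (x^T *m y) 0 0.

Definition spherical_code (R : realType) (alpha beta : R) (m : nat)
    (S : {fset 'cV[R]_m}) : Prop :=
  [/\ S != fset0,
      forall x, x \in S -> dotv x x = 1 &
      forall x y, x \in S -> y \in S -> x != y ->
        dotv x y = alpha \/ dotv x y = beta].

Definition code_rank (R : realType) (m : nat) (S : {fset 'cV[R]_m}) : nat :=
  \dim <<S>>%VS.

Section AlphaGraph.
Variables (R : realType) (alpha : R) (m : nat) (S : {fset 'cV[R]_m}).

Definition alpha_edge : rel S :=
  fun x y => (x != y) && (dotv (val x) (val y) == alpha).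

Lemma alpha_edge_sym : symmetric alpha_edge.
Proof.
move=> x y; rewrite /alpha_edge eq_sym; congr (_ && (_ == _)).
rewrite /dotv !mxE; apply: eq_bigr => i _.
by rewrite !mxE mulrC.
Qed.

Lemma alpha_edge_irr : irreflexive alpha_edge.
Proof. by move=> x; rewrite /alpha_edge eqxx. Qed.

Definition alpha_graph : sgraph := SGraph alpha_edge_sym alpha_edge_irr.

End AlphaGraph.

Definition code_mu (R : realType) (alpha beta : R) : R :=
  (1 - beta) / (alpha - beta).

Definition eigenvalue_cond (R : realType) (alpha beta : R) (G : sgraph)
    (n : nat) : Prop :=
  lambda (adjmx R G) n >= - code_mu alpha beta.

Definition rank_cond (R : realType) (alpha beta : R) (G : sgraph)
    (r : int) : Prop :=
  let M := adjmx R G + (code_mu alpha beta)%:M in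
  let j := const_mx 1 : 'cV[R]_#|G| in
  let q := (j^T *m group_inverse M *m j) 0 0 in
  let c := (alpha - beta) / - beta in
  [/\ colspace M j, q <= c &
      (\rank M)%:Z = if q == c then r + 1 else r].

(* Main.v *)
(** The Gram matrix of a code with graph G is P = (alpha - beta) M + beta J, where
M = A + mu I, so M is a positive multiple of P - beta J. If P is positive
semidefinite then so is M, and its kernel is orthogonal to j, so j = M x for
some x. Writing q = x^T j = j^T M^# j, the form of P at x is
q (alpha - beta + beta q), which bounds q; conversely, Cauchy-Schwarz for the
form of M turns the bound on q into positive semidefiniteness of P. Removing the
rank-one term -beta j j^T lowers the rank of M, by one, exactly when P x = 0,
i.e. when the bound on q is attained. A code is recovered from P as the rows of
a real matrix B with P = B B^T; here B comes from the complex spectral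
theorem. *)
Require Import Defs.
From mathcomp Require Import all_boot all_order all_algebra.
From mathcomp Require Import sesquilinear spectral complex.
From mathcomp Require Import ring lra.
From mathcomp Require Import finmap.
From mathcomp Require Import boolp classical_sets reals.

Set Implicit Arguments.
Unset Strict Implicit.
Unset Printing Implicit Defensive.

Import Order.TTheory GRing.Theory Num.Theory.
Import VectorInternalTheory.
Local Open Scope fset_scope.
Local Open Scope ring_scope.

(** * Left kernels and conjugation over a field *)

Lemma mxrank_eq_kernel (F : fieldType) n p q (A : 'M[F]_(n, p))
    (B : 'M[F]_(n, q)) :
  (forall u : 'rV_n, (u *m A == 0) = (u *m B == 0)) -> \rank A = \rank B.
Proof.
move=> kerAB; suff eq_ker : \rank (kermx A) = \rank (kermx B).
  move: eq_ker; rewrite !mxrank_ker => /(f_equal (subn n)).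
  by rewrite !subKn ?rank_leq_row.
apply: eqmx_rank; apply/andP; split; apply/rV_subP => u.
  by move=> /sub_kermxP/eqP; rewrite kerAB => /eqP/sub_kermxP.
by move=> /sub_kermxP/eqP; rewrite -kerAB => /eqP/sub_kermxP.
Qed.

Lemma char_poly_conj (F : fieldType) n (V D U : 'M[F]_n) :
  V *m U = 1%:M -> char_poly (V *m D *m U) = char_poly D.
Proof.
move=> VU1; pose f := @polyC F.
have VUf : map_mx f V *m map_mx f U = 1%:M by rewrite -map_mxM VU1 map_mx1.
rewrite /char_poly /char_poly_mx.
have -> : 'X%:M - map_mx f (V *m D *m U) =
    map_mx f V *m ('X%:M - map_mx f D) *m map_mx f U.
  rewrite !map_mxM mulmxBr mulmxBl; congr (_ - _).
  by rewrite scalar_mxC -mulmxA VUf mulmx1.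
by rewrite !det_mulmx mulrAC -det_mulmx VUf det1 mul1r.
Qed.

(** * Spectral theorem for real symmetric matrices *)

Section RealSymmetric.
Variable R : rcfType.
Local Notation toC := (real_complex R).

(** Over [R[i]] the matrix [A] is Hermitian, hence normal, so it is unitarily diagonalizable; its
    eigenvalues are real, so [d] can be taken over [R]. *)
Lemma symmetric_spectral n (A : 'M[R]_n) : A^T = A ->
  exists (U : 'M[R[i]]_n) (d : 'rV[R]_n),
    U *m (map_mx conjc U)^T = 1%:M /\
    map_mx toC A = (map_mx conjc U)^T *m diag_mx (map_mx toC d) *m U.
Proof.
move=> symA; pose Ac := map_mx toC A.
have hermA : Ac \is hermsymmx.
  apply/is_hermitianmxP; rewrite expr0 scale1r.
  apply/matrixP => i j; rewrite !mxE -[in LHS]symA mxE.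
  exact/esym/(conjc_real (A j i)).
have unitU := spectral_unitarymx Ac.
exists (spectralmx Ac), (map_mx (@complex.Re R) (spectral_diag Ac)); split.
  by have /unitarymxP := unitU; rewrite map_trmx.
have -> : map_mx toC (map_mx (@complex.Re R) (spectral_diag Ac)) =
    spectral_diag Ac.
  apply/rowP => j; rewrite !mxE; apply: RRe_real.
  by have /mxOverP/(_ 0 j) := hermitian_spectral_diag_real hermA.
have /orthomx_spectralP := hermitian_normalmx hermA.
by rewrite (invmx_unitary unitU) map_trmx => AE; exact: AE.
Qed.

Lemma symmetric_char_poly_split n (A : 'M[R]_n) : A^T = A ->
  exists s : seq R, char_poly A = \prod_(x <- s) ('X - x%:P).
Proof.
move=> /symmetric_spectral[U [d [UU AE]]]; exists [seq d 0 i | i : 'I_n].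
apply: (map_poly_inj toC); rewrite map_char_poly /= AE char_poly_conj; last first.
  exact: mulmx1C.
rewrite char_poly_trig ?diag_mx_is_trig // rmorph_prod /= big_map /= big_enum /=.
by apply: eq_bigr => i _; rewrite rmorphB /= map_polyX map_polyC !mxE eqxx.
Qed.

(* With A = U^* D U, the real and imaginary parts of the rows of sqrt(D) U
   give a real factor with twice as many columns. *)
Lemma symmetric_nonneg_factor n (A : 'M[R]_n) : A^T = A ->
  (forall a, eigenvalue A a -> 0 <= a) ->
  exists B : 'M[R]_(n, n + n), A = B *m B^T.
Proof.
move=> /symmetric_spectral[U [d [UU AE]]] eig_ge0.
have d_ge0 k : 0 <= d 0 k.
  (* Row [k] of [U] is an eigenvector over [R[i]] only; the eigenvalue descends to [R] as a root of
     the characteristic polynomial. *)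
  apply: eig_ge0; rewrite eigenvalue_root_char -(fmorph_root toC) map_char_poly.
  rewrite -eigenvalue_root_char; apply/eigenvalueP; exists (row k U).
    rewrite AE -!row_mul !mulmxA UU mul1mx.
    by apply/rowP => j; rewrite mxE mul_diag_mx !mxE.
  apply/eqP => U0; have /matrixP/(_ k k) := UU.
  rewrite !mxE eqxx big1 => [/eqP|i _]; first by rewrite eq_sym oner_eq0.
  by have /rowP/(_ i) := U0; rewrite !mxE => ->; rewrite mul0r.
pose part (f : R[i] -> R) := \matrix_(i < n, k < n) (Num.sqrt (d 0 k) * f (U k i)).
exists (row_mx (part (@complex.Re R)) (part (@complex.Im R))).
rewrite tr_row_mx mul_row_col; apply/matrixP => i j.
have -> : A i j = complex.Re (map_mx toC A i j) by rewrite mxE.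
rewrite AE !mxE (big_morph (@complex.Re R) (id1 := 0) (op1 := +%R)) => [||//].
  rewrite -big_split; apply: eq_bigr => k _ /=.
  (* The real part of [conj(y) * z] is [Re y * Re z + Im y * Im z], which the two blocks supply. *)
  rewrite mul_mx_diag !mxE; have := sqr_sqrtr (d_ge0 k).
  move: (Num.sqrt _) => t <-; case: (U k i) (U k j) => [x y] [z w] /=; ring.
by move=> [x y] [z w].
Qed.

End RealSymmetric.

(** * The sorted eigenvalue list of a symmetric matrix *)

Section Eigvals.
Variables (R : realType) (n : nat) (A : 'M[R]_n).
Hypothesis symA : A^T = A.

Lemma eigvalsP : sorted >=%R (eigvals A) /\
  char_poly A = \prod_(x <- eigvals A) ('X - x%:P).
Proof.
have [s sE] := symmetric_char_poly_split symA.
(* The default [[::]] is avoided because sorting any splitting list gives a valid choice. *)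
apply: (@xgetPex _ [::] (fun s => sorted >=%R s /\ char_poly A = _)).
exists (sort >=%R s); split.
  by apply: sort_sorted => x y; apply: ge_total.
by rewrite sE; apply: perm_big; rewrite perm_sym perm_sort.
Qed.

Lemma size_eigvals : size (eigvals A) = n.
Proof.
have [_ /(congr1 (size \o polyseq))] := eigvalsP.
by rewrite /= size_char_poly size_prod_XsubC => -[].
Qed.

Lemma mem_eigvals a : (a \in eigvals A) = eigenvalue A a.
Proof.
by rewrite eigenvalue_root_char; case: eigvalsP => _ ->; rewrite root_prod_XsubC.
Qed.

Lemma eigenvalue_lambda_last : (0 < n)%N -> eigenvalue A (lambda A n).
Proof. by move=> n0; rewrite -mem_eigvals mem_nth // size_eigvals prednK. Qed.

Lemma lambda_last_le a : eigenvalue A a -> lambda A n <= a.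
Proof.
rewrite -mem_eigvals => /(nthP 0)[i ltin <-].
rewrite /lambda; have [sorted_eig _] := eigvalsP.
apply: (sorted_leq_nth _ _ 0 sorted_eig) => //.
- by move=> y x z xy yz; apply: le_trans yz xy.
- by move=> x; apply: lexx.
- by move: ltin; rewrite !inE size_eigvals; case: (n).
by move: ltin; rewrite size_eigvals; case: (n).
Qed.

End Eigvals.

(** * Positive semidefinite forms, Gram matrices and group inverses *)

(** Stated with row vectors, to match left eigenvectors and left kernels; symmetry is kept as a
    separate hypothesis. *)
Definition psd (R : realFieldType) n (M : 'M[R]_n) :=
  forall u : 'rV_n, 0 <= (u *m M *m u^T) 0 0.

Lemma row_dot_eq0 (R : realFieldType) n (u : 'rV[R]_n) :
  ((u *m u^T) 0 0 == 0) = (u == 0).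
Proof.
apply/idP/eqP => [|->]; last by rewrite mul0mx mxE.
rewrite mxE psumr_eq0 => [/allP u0|i _]; last by rewrite mxE -expr2 sqr_ge0.
apply/rowP => i; have := u0 i; rewrite mem_index_enum !mxE => /(_ isT).
by rewrite mulf_eq0 orbb => /eqP.
Qed.

Lemma row_dot_ge0 (R : realFieldType) n (u : 'rV[R]_n) : 0 <= (u *m u^T) 0 0.
Proof. by rewrite mxE sumr_ge0 // => i _; rewrite mxE -expr2 sqr_ge0. Qed.

Lemma psd_gram (R : realFieldType) n m (B : 'M[R]_(n, m)) : psd (B *m B^T).
Proof. by move=> u; rewrite mulmxA -mulmxA -trmx_mul row_dot_ge0. Qed.

Lemma psd_eigenvalue_ge0 (R : realFieldType) n (M : 'M[R]_n) a :
  psd M -> eigenvalue M a -> 0 <= a.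
Proof.
move=> psdM /eigenvalueP[u uM u0]; have := psdM u.
rewrite uM -scalemxAl mxE pmulr_lge0 //.
by rewrite lt0r row_dot_ge0 row_dot_eq0 u0.
Qed.

Lemma psd_factor (R : rcfType) n (M : 'M[R]_n) : M^T = M -> psd M ->
  exists B : 'M[R]_(n, n + n), M = B *m B^T.
Proof.
by move=> symM psdM; apply: symmetric_nonneg_factor => // a; apply: psd_eigenvalue_ge0.
Qed.

(** If a row [u] satisfies [u B B^T = 0], then [u B] has squared norm [u B B^T u^T = 0]. *)
Lemma mulmx_gram_eq0 (R : realFieldType) n m p (B : 'M[R]_(n, m))
    (u : 'M[R]_(p, n)) : (u *m (B *m B^T) == 0) = (u *m B == 0).
Proof.
apply/eqP/eqP => [uBB|uB0]; last by rewrite mulmxA uB0 mul0mx.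
apply/row_matrixP => i; rewrite row0; apply/eqP; rewrite -row_dot_eq0.
rewrite row_mul trmx_mul mulmxA -[_ *m B *m _]mulmxA -row_mul uBB row0.
by rewrite mul0mx mxE.
Qed.

Lemma mxrank_gram (R : realFieldType) n m (B : 'M[R]_(n, m)) :
  \rank (B *m B^T) = \rank B.
Proof. by apply: mxrank_eq_kernel => u; rewrite mulmx_gram_eq0. Qed.

(* M^2 = M M^T has the row space of M, so M = Y M^2 for some Y, whence Y M Y^T
   is the group inverse. *)
Lemma symmetric_group_inverse (R : realType) n (M : 'M[R]_n) : M^T = M ->
  is_group_inverse M (group_inverse M).
Proof.
move=> symM; apply: (@xgetPex _ 0 (is_group_inverse M)).
have /andP[_ /submxP[Y ME]] : (M *m M == M)%MS.
  have := mxrank_gram M; rewrite symM => rankM2.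
  by rewrite -(mxrank_leqif_eq (submxMl M M)).2 rankM2.
have ME' : M = M *m M *m Y^T by rewrite -{1}symM {1}ME !trmx_mul symM.
have EE : Y *m M = M *m Y^T by rewrite {1}ME' !mulmxA -[Y *m M *m M]mulmxA -ME.
have EM : Y *m M *m M = M by rewrite -mulmxA -ME.
have ME1 : M *m (Y *m M) = M by rewrite EE mulmxA -ME'.
have MX : M *m (Y *m M *m Y^T) = Y *m M by rewrite mulmxA ME1 EE.
have XM : Y *m M *m Y^T *m M = Y *m M.
  by rewrite -[Y *m M *m Y^T]mulmxA -EE -[Y *m (Y *m M) *m M]mulmxA EM.
exists (Y *m M *m Y^T); split; first by rewrite MX EM.
  by rewrite XM -[LHS]mulmxA MX -[RHS]mulmxA -EE.
by rewrite MX XM.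
Qed.

(** * Subtracting a rank-one term from a symmetric matrix *)

Lemma mul_rank_one_update (R : realFieldType) n (M : 'M[R]_n) (v : 'cV[R]_n) a b
    (u : 'rV[R]_n) :
  u *m (a *: M - b *: (v *m v^T)) =
  a *: (u *m M) - (b * (u *m v) 0 0) *: v^T.
Proof.
rewrite mulmxBr -!scalemxAr; congr (_ - _); rewrite -scalerA; congr (_ *: _).
by rewrite mulmxA [in LHS](mx11_scalar (u *m v)) mul_scalar_mx.
Qed.

Lemma rank_one_update_form (R : realFieldType) n (M : 'M[R]_n) (v : 'cV[R]_n) a b
    (u : 'rV[R]_n) :
  (u *m (a *: M - b *: (v *m v^T)) *m u^T) 0 0 =
  a * (u *m M *m u^T) 0 0 - b * (u *m v) 0 0 ^+ 2.
Proof.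
rewrite mul_rank_one_update mulmxBl -!scalemxAl -trmx_mul [u *m v]mx11_scalar.
by rewrite tr_scalar_mx !mxE !eqxx !mulr1n expr2 mulrA.
Qed.

Lemma psd_of_rank_one_update (R : realFieldType) n (M : 'M[R]_n) (v : 'cV[R]_n)
    a b :
  0 < a -> 0 <= b -> psd (a *: M - b *: (v *m v^T)) -> psd M.
Proof.
move=> a_gt0 b_ge0 psdP u; have := psdP u; rewrite rank_one_update_form.
rewrite subr_ge0 => /(le_trans (mulr_ge0 b_ge0 (sqr_ge0 _))).
by rewrite pmulr_rge0.
Qed.

(** Fredholm alternative: the column space is the annihilator of the left kernel, which is tested on
    the rows of a transposed cokernel matrix. *)
Lemma left_kernel_colspace (F : fieldType) m n (A : 'M[F]_(m, n)) (v : 'cV[F]_m) :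
  (forall u : 'rV_m, u *m A = 0 -> u *m v = 0) -> exists x, A *m x = v.
Proof.
move=> kerA; suff /submxP[y vE] : (v^T <= A^T)%MS.
  by exists y^T; apply: trmx_inj; rewrite trmx_mul trmxK.
rewrite submxE -[cokermx _]trmxK -trmx_mul trmx_eq0; apply/eqP/row_matrixP => i.
rewrite row_mul row0; apply: kerA; rewrite -row_mul -[A in _ *m A]trmxK -trmx_mul.
by rewrite mulmx_coker trmx0 row0.
Qed.

(** If [u M = 0], the form at [u] is [- b (u v)^2], and its nonnegativity forces [u v = 0]. *)
Lemma psd_update_colspace (R : realFieldType) n (M : 'M[R]_n) (v : 'cV[R]_n) a b :
  0 < b -> psd (a *: M - b *: (v *m v^T)) -> exists x, M *m x = v.
Proof.
move=> b_gt0 psdP; apply: left_kernel_colspace => u uM0; have := psdP u.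
rewrite rank_one_update_form uM0 mul0mx [X in a * X]mxE mulr0 sub0r oppr_ge0.
rewrite pmulr_rle0 // => uv_le0.
have uv0 : (u *m v) 0 0 = 0.
  by apply/eqP; rewrite -sqrf_eq0 eq_le uv_le0 sqr_ge0.
by rewrite [u *m v]mx11_scalar uv0 raddf0.
Qed.

Section RankOneUpdate.
Variables (R : realFieldType) (n : nat) (M : 'M[R]_n) (x : 'cV[R]_n) (a b : R).
Hypotheses (symM : M^T = M) (a_gt0 : 0 < a) (b_gt0 : 0 < b).
Let j := M *m x.
Let q := (x^T *m j) 0 0.
Let P : 'M[R]_n := a *: M - b *: (j *m j^T).

(** Entry rules for single operations, since [mxE] would also expand matrix products into sums. *)
Let entryB (A B : 'M[R]_1) : (A - B) 0 0 = A 0 0 - B 0 0.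
Proof. by rewrite !mxE. Qed.
Let entryZ c (A : 'M[R]_1) : (c *: A) 0 0 = c * A 0 0.
Proof. by rewrite mxE. Qed.
Let entryT (A : 'M[R]_1) : A^T 0 0 = A 0 0. Proof. by rewrite mxE. Qed.

Let entry_dot (v : 'rV[R]_n) (w : 'cV[R]_n) :
  (w^T *m v^T) 0 0 = (v *m w) 0 0.
Proof. by rewrite -trmx_mul entryT. Qed.

Let jx : (j^T *m x) 0 0 = q.
Proof. by rewrite -[x in LHS]trmxK entry_dot. Qed.

Let trj : j^T = x^T *m M. Proof. by rewrite trmx_mul symM. Qed.

Lemma update_form_preimage : (x^T *m P *m x) 0 0 = q * (a - b * q).
Proof.
have := rank_one_update_form M j a b x^T; rewrite trmxK -[_ *m M *m x]mulmxA -/j -/q => ->.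
ring.
Qed.

(* The form of M at u - (b/a)(u j) x^T is nonnegative. *)
Lemma psd_update : psd M -> q <= a / b -> psd P.
Proof.
move=> psdM le_q u; rewrite rank_one_update_form; set s := (u *m j) 0 0.
pose t := b / a * s; have := psdM (u - t *: x^T).
have -> : ((u - t *: x^T) *m M *m (u - t *: x^T)^T) 0 0 =
    (u *m M *m u^T) 0 0 - t * s *+ 2 + t ^+ 2 * q.
  rewrite [(u - _)^T]linearB /= [(t *: _)^T]linearZ /= trmxK.
  rewrite !mulmxBl !mulmxBr -!scalemxAl -!scalemxAr.
  rewrite -trj -[_ *m M *m x]mulmxA -/j.
  rewrite !(entryB, entryZ) entry_dot jx -/s.
  ring.
set m := (_ *m _) 0 0 => form_ge0.
rewrite subr_ge0 -ler_pdivrMl //.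
(* The first bound is the nonnegative form; the second follows from [t^2 q <= t^2 (a / b) = t s]. *)
apply: le_trans (_ : t * s *+ 2 - t ^+ 2 * q <= _); last by lra.
have -> : a^-1 * (b * s ^+ 2) = t * s by rewrite /t; ring.
have ts : t ^+ 2 * (a / b) = t * s by rewrite /t; field; rewrite !gt_eqF.
have : t ^+ 2 * q <= t ^+ 2 * (a / b) by rewrite ler_wpM2l ?sqr_ge0.
by rewrite ts; lra.
Qed.

(** If [q > a / b > 0], the form of [P] at [x^T], namely [q (a - b q)], would be negative. *)
Lemma le_form_of_psd_update : psd P -> q <= a / b.
Proof.
move=> /(_ x^T); rewrite trmxK update_form_preimage => q_ge0.
rewrite leNgt; apply/negP; rewrite ltr_pdivrMr // => lt_q.
have q_gt0 : 0 < q by rewrite -(pmulr_lgt0 _ b_gt0) (lt_trans a_gt0).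
by move: q_ge0; rewrite pmulr_rge0 // subr_ge0 mulrC leNgt lt_q.
Qed.

Lemma mxrank_update : \rank M = (\rank P + (q == a / b))%N.
Proof.
have [/eqP qab|qab] := boolP (q == a / b); last first.
  rewrite addn0; apply: mxrank_eq_kernel => u; apply/eqP/eqP => [uM0|uP0].
    by rewrite mul_rank_one_update uM0 scaler0 mulmxA uM0 mul0mx mxE mulr0 scale0r subr0.
  (* Pairing [u P = 0] with [x] gives [(u j) (a - b q) = 0], and [a - b q] is nonzero here. *)
  have uj0 : (u *m j) 0 0 = 0.
    have := congr1 (fun v => (v *m x) 0 0) uP0.
    rewrite /= mul0mx [RHS]mxE mul_rank_one_update mulmxBl -!scalemxAl -mulmxA -/j.
    rewrite entryB !entryZ jx.
    rewrite mulrAC -mulrBl => /eqP; rewrite mulf_eq0 => /orP[|/eqP //].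
    rewrite subr_eq0 => /eqP aE; case/eqP: qab.
    by rewrite aE mulrC mulKf // gt_eqF.
  move: uP0; rewrite mul_rank_one_update uj0 mulr0 scale0r subr0 => /eqP.
  by rewrite scaler_eq0 gt_eqF // => /eqP.
have bq : b * q = a by rewrite qab mulrC divfK // gt_eqF.
have Px0 : P *m x = 0.
  rewrite mulmxBl -!scalemxAl -mulmxA (mx11_scalar (j^T *m x)) jx.
  by rewrite mul_mx_scalar scalerA bq subrr.
apply/eqP; rewrite eqn_leq; apply/andP; split.
  have -> : \rank M = \rank (P + b *: (j *m j^T))%R.
    by rewrite subrK mxrank_scale_nz // gt_eqF.
  apply: leq_trans (mxrank_add _ _) _; rewrite leq_add2l mxrank_scale_nz ?gt_eqF //.
  by apply: leq_trans (mxrankM_maxl _ _) _; apply: rank_leq_col.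
have PE : (P <= M)%MS.
  (* Since [j^T = x^T M], the rank-one term also factors through [M]. *)
  rewrite (_ : P = (a%:M - b *: (j *m x^T)) *m M) ?submxMl //.
  by rewrite mulmxBl mul_scalar_mx -scalemxAl -mulmxA -trj.
(* If [M = Y P], then [j = M x = Y P x = 0], so [q = 0], against [b q = a > 0]. *)
rewrite addn1; apply: rank_ltmx; rewrite ltmxE PE /=; apply/negP => /submxP[Y ME].
have j0 : j = 0 by rewrite /j ME -mulmxA Px0 mulmx0.
by move: bq; rewrite /q j0 mulmx0 mxE mulr0 => a0; have := a_gt0; rewrite -a0 ltxx.
Qed.

End RankOneUpdate.

(** * Dimension of a span as a matrix rank *)

Lemma dim_span_rows (R : fieldType) m n (X : seq 'cV[R]_m) (s : 'I_n -> 'cV[R]_m) :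
  (forall y, (y \in X) = (y \in codom s)) ->
  \dim <<X>> = \rank (\matrix_i (s i)^T).
Proof.
move=> Xs.
have -> : \dim <<X>> = \rank (\matrix_(i < size X) (X`_i)^T).
  (* The span is stored in the coordinates [v2r]; in either matrix a row [u] is in the left kernel
     exactly when the combination of [X] with coefficients [u] vanishes. *)
  rewrite /dimv [span]unlock /= genmxE; apply: mxrank_eq_kernel => u.
  have uE : u *m b2mx (in_tuple X) = v2r (\sum_i u 0 i *: X`_i).
    rewrite mulmx_sum_row linear_sum; apply: eq_bigr => i _.
    by rewrite linearZ rowK (tnth_nth 0).
  have -> : u *m \matrix_i (X`_i)^T = (\sum_i u 0 i *: X`_i)^T.
    rewrite mulmx_sum_row linear_sum; apply: eq_bigr => i _.
    by rewrite linearZ rowK.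
  by rewrite uE trmx_eq0 raddf_eq0 //; apply: v2r_inj.
(* The two matrices have the same rows up to order and repetition. *)
apply: eqmx_rank; apply/andP; split; apply/row_subP => i; rewrite rowK.
  have : X`_i \in codom s by rewrite -Xs mem_nth.
  by case/codomP => k ->; rewrite -(rowK (fun k => (s k)^T)) row_sub.
have : s i \in X by rewrite Xs codom_f.
case/(nthP 0) => k ltk <-.
by rewrite -(rowK (fun k : 'I_(size X) => (X`_k)^T) (Ordinal ltk)) row_sub.
Qed.

(** * Shifted spectra and the form of the group inverse *)

Lemma eigenvalue_add_scalar (F : fieldType) n (A : 'M[F]_n) (c a : F) :
  eigenvalue (A + c%:M) a = eigenvalue A (a - c).
Proof. by rewrite /eigenvalue /eigenspace raddfB /= opprB addrA. Qed.

(** The shift by [c] moves every eigenvalue by [c], and a symmetric matrix with nonnegative spectrum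
    is a Gram matrix. For [0 < n], [lambda A n] is a true eigenvalue and not the default of
    [nth]. *)
Lemma lambda_last_ge (R : realType) n (A : 'M[R]_n) (c : R) :
  A^T = A -> (0 < n)%N -> (- c <= lambda A n) <-> psd (A + c%:M).
Proof.
move=> symA n_gt0; split=> [le_lambda|psdM]; last first.
  have := eigenvalue_lambda_last symA n_gt0.
  rewrite -[lambda A n](addrK c) -eigenvalue_add_scalar => /psd_eigenvalue_ge0.
  by move=> /(_ psdM); rewrite addrK -lerBlDr sub0r.
have [||B ->] := @symmetric_nonneg_factor R n (A + c%:M).
- by rewrite raddfD /= tr_scalar_mx symA.
- move=> a; rewrite eigenvalue_add_scalar => /(lambda_last_le symA).
  by move=> /(le_trans le_lambda); rewrite lerBrDr addrC subrr.
exact: psd_gram.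
Qed.

(** By [M M^# M = M], the value [j^T M^# j] can be computed from any preimage [x] of [j]. *)
Lemma group_inverse_form (R : realType) n (M : 'M[R]_n) (x : 'cV[R]_n) :
  M^T = M ->
  (M *m x)^T *m group_inverse M *m (M *m x) = x^T *m (M *m x).
Proof.
move=> symM; have [MXM _ _] := symmetric_group_inverse symM.
by rewrite trmx_mul symM -[in RHS]MXM !mulmxA.
Qed.

Lemma adjmx_sym (R : realType) (G : sgraph) : (adjmx R G)^T = adjmx R G.
Proof. by apply/matrixP => i k; rewrite !mxE sedge_sym. Qed.

(** * The Gram matrix prescribed by a graph *)

Section CodeGram.
Variables (R : realType) (alpha beta : R) (G : sgraph).
Hypotheses (hbetaalpha : beta < alpha) (hbeta0 : beta < 0).

Let M := adjmx R G + (code_mu alpha beta)%:M.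
Let ones : 'cV[R]_#|G| := const_mx 1.

Definition code_gram : 'M[R]_#|G| :=
  \matrix_(i, k) if i == k then 1 else
    if sedge (enum_val i) (enum_val k) then alpha else beta.

Let ab_gt0 : 0 < alpha - beta. Proof. by rewrite subr_gt0. Qed.
Let nb_gt0 : 0 < - beta. Proof. by rewrite oppr_gt0. Qed.
Let symM : M^T = M.
Proof. by rewrite raddfD /= tr_scalar_mx adjmx_sym. Qed.

Lemma code_gramE : code_gram = (alpha - beta) *: M - (- beta) *: (ones *m ones^T).
Proof.
apply/matrixP => i k; rewrite !mxE big_ord1 !mxE.
have [<-|] := eqVneq i k.
  (* On the diagonal, [(alpha - beta) mu = 1 - beta]; this is what fixes [mu]. *)
  by rewrite sedge_irr /code_mu /= mulr1n add0r mulrC divfK ?gt_eqF //; ring.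
by case: (sedge _ _) => _; rewrite /= mulr0n; ring.
Qed.

Lemma code_gram_sym : code_gram^T = code_gram.
Proof. by apply/matrixP => i k; rewrite !mxE eq_sym sedge_sym. Qed.

(** Both directions of the theorem go through this equivalence: the rank-one results apply with
    [a = alpha - beta] and [b = - beta], so [a / b] is the bound in [rank_cond]. *)
Lemma psd_code_gramP r : (0 < #|G|)%N ->
  psd code_gram /\ (\rank code_gram)%:Z = r <->
  eigenvalue_cond alpha beta G #|G| /\ rank_cond alpha beta G r.
Proof.
move=> G_gt0; rewrite /eigenvalue_cond /rank_cond -/M -/ones.
have eig_psd := lambda_last_ge (code_mu alpha beta) (adjmx_sym R G) G_gt0.
rewrite code_gramE; split=> [[psdP rkP]|[/eig_psd psdM [[x _ Mx] le_q rkM]]].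
  split; first by apply/eig_psd/(psd_of_rank_one_update ab_gt0 (ltW nb_gt0) psdP).
  have [x Mx] := psd_update_colspace nb_gt0 psdP.
  move: psdP rkP; rewrite -Mx group_inverse_form // => psdP rkP.
  have le_q := le_form_of_psd_update ab_gt0 nb_gt0 psdP.
  have rkM := mxrank_update x symM ab_gt0 nb_gt0.
  split=> //; first by exists x.
  by rewrite rkM -rkP; case: (_ == _); rewrite ?addn1 ?addn0 ?intS 1?addrC.
move: le_q rkM; rewrite -Mx group_inverse_form // => le_q.
rewrite (mxrank_update x symM ab_gt0 nb_gt0) => rkM.
split; first exact: psd_update.
by move: rkM; case: (_ == _); rewrite ?addn0 // PoszD => /addIr.
Qed.

End CodeGram.

(** * From codes to Gram matrices and back *)

Lemma dotv_mul (R : realType) n m (B : 'M[R]_(n, m)) i k :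
  dotv (row i B)^T (row k B)^T = (B *m B^T) i k.
Proof.
by rewrite /dotv trmxK !mxE; apply: eq_bigr => l _; rewrite !mxE.
Qed.

(** The rows of [B] are the code vectors, in the order in which [adjmx] lists the vertices. *)
Lemma spherical_code_gram (R : realType) (alpha beta : R) m (S : {fset 'cV[R]_m}) :
  spherical_code alpha beta S ->
  exists B : 'M[R]_(#|alpha_graph alpha S|, m),
    code_gram alpha beta (alpha_graph alpha S) = B *m B^T /\ code_rank S = \rank B.
Proof.
move=> [_ unitS dotS]; pose G := alpha_graph alpha S.
pose s (i : 'I_#|G|) : 'cV[R]_m := val (enum_val i : S).
exists (\matrix_i (s i)^T); split; last first.
  apply: dim_span_rows => y; apply/idP/codomP => [Sy|[i ->]]; last exact: fsvalP.
  by exists (enum_rank ([` Sy] : G)); rewrite /s enum_rankK.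
apply/matrixP => i k; rewrite -dotv_mul !rowK !trmxK [LHS]mxE.
have [<-|nik] := eqVneq i k; first by rewrite unitS // fsvalP.
have nval : s i != s k by rewrite (inj_eq val_inj) (inj_eq enum_val_inj).
rewrite /= /alpha_edge (inj_eq enum_val_inj) nik /= -/(s i) -/(s k).
by case: eqP => // ne; case: (dotS (s i) (s k)) => //; apply: fsvalP.
Qed.

Lemma gram_spherical_code (R : realType) (alpha beta : R) (G : sgraph) m
    (B : 'M[R]_(#|G|, m)) :
  beta < alpha -> alpha < 1 -> (0 < #|G|)%N ->
  code_gram alpha beta G = B *m B^T ->
  exists S : {fset 'cV[R]_m}, [/\ spherical_code alpha beta S,
    code_rank S = \rank B & sgraph_iso (alpha_graph alpha S) G].
Proof.
move=> hba ha1 G_gt0 BE; pose f (v : G) : 'cV[R]_m := (row (enum_rank v) B)^T.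
have dotf v w : dotv (f v) (f w) =
    if v == w then 1 else if sedge v w then alpha else beta.
  by rewrite dotv_mul -BE mxE (inj_eq enum_rank_inj) !enum_rankK.
(* Coinciding vectors would have inner product 1, but distinct vertices give [alpha] or [beta], both
   below 1. *)
have f_inj : injective f.
  move=> v w fvw; apply/eqP; have := dotf v w; rewrite fvw dotf eqxx.
  case: (v == w) => //; case: (sedge _ _) => /eqP; rewrite gt_eqF //.
  exact: lt_trans ha1.
pose S := [fset f v | v in G].
have Sf v : f v \in S by apply: in_imfset.
exists S; split.
- split.
  + by case/card_gt0P: G_gt0 => v _; apply/fset0Pn; exists (f v).
  + by move=> y /imfsetP[v _ ->]; rewrite dotf eqxx.
  move=> y z /imfsetP[v _ ->] /imfsetP[w _ ->]; rewrite dotf (inj_eq f_inj).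
  by move=> /negbTE ->; case: (sedge _ _); [left|right].
- rewrite /code_rank (@dim_span_rows _ _ _ _ (fun i => (row i B)^T)).
    by congr (\rank _); apply/row_matrixP => i; rewrite rowK trmxK.
  move=> y; apply/imfsetP/codomP => [[v _ ->]|[i ->]]; first by exists (enum_rank v).
  by exists (enum_val i) => //; rewrite /f enum_valK.
pose g (v : G) : alpha_graph alpha S := [` Sf v].
have [h gK hK] : bijective g.
  apply: inj_card_bij => [v w /(congr1 val)/f_inj //|].
  rewrite -cardfE card_imfset //= -cardE; exact: leqnn.
(* The isomorphism goes from the code to [G], so it is the inverse of [g]. *)
exists h; first by exists g.
move=> y z; rewrite -[y]hK -[z]hK !gK /= /alpha_edge dotf.
rewrite -(inj_eq val_inj) /= (inj_eq f_inj).
have [->|] := eqVneq (h y) (h z); first by rewrite sedge_irr.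
by case: (sedge _ _) => _; rewrite ?eqxx // lt_eqF.
Qed.

Theorem theorem3p1 (R : realType) (alpha beta : R)
    (hbeta1 : -1 <= beta) (hbetaalpha : beta < alpha) (halpha1 : alpha < 1)
    (hbeta0 : beta < 0) :
  (forall (m n r : nat) (S : {fset 'cV[R]_m}),
      spherical_code alpha beta S -> #|` S| = n -> code_rank S = r ->
      eigenvalue_cond alpha beta (alpha_graph alpha S) n /\
      rank_cond alpha beta (alpha_graph alpha S) r%:Z) /\
  (forall (n : nat) (r : int) (G : sgraph),
      (0 < n)%N -> #|G| = n ->
      eigenvalue_cond alpha beta G n -> rank_cond alpha beta G r ->
      exists (m : nat) (S : {fset 'cV[R]_m}),
        [/\ spherical_code alpha beta S, (code_rank S)%:Z = r &
            sgraph_iso (alpha_graph alpha S) G]).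
Proof.
split=> [m n r S codeS <- <-|n r G n_gt0 cardG].
  have [B [gramE ->]] := spherical_code_gram codeS.
  have S_gt0 : (0 < #|alpha_graph alpha S|)%N.
    by case: codeS => + _ _; rewrite -cardfs_gt0 cardfE.
  rewrite cardfE; apply/psd_code_gramP => //.
  by rewrite gramE mxrank_gram; split=> //; apply: psd_gram.
rewrite -cardG in n_gt0 *; move=> eigG rankG.
have [psdP rkP] :=
  (psd_code_gramP hbetaalpha hbeta0 r n_gt0).2 (conj eigG rankG).
have [B BE] := psd_factor (code_gram_sym alpha beta G) psdP.
have [S [codeS rkS isoS]] := gram_spherical_code hbetaalpha halpha1 n_gt0 BE.
(* The ambient dimension is [#|G| + #|G|], the width of the real factor [B]. *)
exists _, S; split=> //.
by rewrite rkS -mxrank_gram -BE.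
Qed.
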